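(* Let $F,G:\mathbf{Sets}\to\mathbf{Sets}$ be functors, $\alpha:F\Rightarrow G$ a natural transformation all of whose components are surjective, and $\sqsubseteq_G$ an order on $G$. Let $b_1:X_1\to GX_1$, $b_2:X_2\to GX_2$ be $G$-coalgebras and $a_1:X_1\to FX_1$, $a_2:X_2\to FX_2$ any maps with $\alpha_{X_1}\circ a_1=b_1$ and $\alpha_{X_2}\circ a_2=b_2$. Then a relation $R\subseteq X_1\times X_2$ is a $\sqsubseteq_G$-simulation between $b_1$ and $b_2$ if and only if it is a $\sqsubseteq_G^{\alpha-}$-simulation between $a_1$ and $a_2$.
   Context: An order on a functor $F$ is a family of preorders $\sqsubseteq_X\subseteq FX\times FX$ such that for all $f:X\to Y$, $u\sqsubseteq_X u'$ implies $Ff(u)\sqsubseteq_Y Ff(u')$. For $R\subseteq X_1\times X_2$ with projections $r_1,r_2$, $R$ is a $\sqsubseteq$-simulation between coalgebras $c:X_1\to FX_1$, $d:X_2\to FX_2$ if for all $(x,y)\in R$ there is $w\in FR$ with $c(x)\sqsubseteq Fr_1(w)$ and $Fr_2(w)\sqsubseteq d(y)$. A natural transformation is a family $\alpha_X:FX\to GX$ with $Gf\circ\alpha_X=\alpha_Y\circ Ff$. The induced order $\sqsubseteq_G^{\alpha-}$ on $F$ is given by $u\sqsubseteq_G^{\alpha-}u'$ iff $\alpha_X(u)\sqsubseteq_G\alpha_X(u')$ for $u,u'\in FX$. *)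

(* Defs.v *)
From Stdlib Require Import RelationClasses FinFun.

(* Equality of maps in the category of sets is stated pointwise throughout. *)
Definition Sets := Type.

Record functor := Functor {
  fobj :> Sets -> Sets;
  fmap : forall X Y : Sets, (X -> Y) -> fobj X -> fobj Y;
  fmap_id : forall (X : Sets) (u : fobj X), fmap X X (fun x => x) u = u;
  fmap_comp : forall (X Y Z : Sets) (g : Y -> Z) (f : X -> Y) (u : fobj X),
    fmap X Z (fun x => g (f x)) u = fmap Y Z g (fmap X Y f u)
}.
Arguments fmap F {X Y} f u : rename.

Record nat_trans (F G : functor) := NatTrans {
  component :> forall X : Sets, F X -> G X;
  naturality : forall (X Y : Sets) (f : X -> Y) (u : F X),
    fmap G f (component X u) = component Y (fmap F f u)
}.
Arguments component {F G} alpha X u : rename.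
Arguments naturality {F G} alpha {X Y} f u : rename.

Record order (F : functor) := Order {
  order_rel :> forall X : Sets, F X -> F X -> Prop;
  order_preorder : forall X : Sets, PreOrder (order_rel X);
  order_fmap : forall (X Y : Sets) (f : X -> Y) (u u' : F X),
    order_rel X u u' -> order_rel Y (fmap F f u) (fmap F f u')
}.
Arguments order_rel {F} le X u u' : rename.
Arguments order_preorder {F} le X : rename.
Arguments order_fmap {F} le {X Y} f u u' _ : rename.

Definition graph {X1 X2 : Sets} (R : X1 -> X2 -> Prop) : Sets :=
  {p : X1 * X2 | R (fst p) (snd p)}.

Definition proj_l {X1 X2 : Sets} {R : X1 -> X2 -> Prop} (p : graph R) : X1 :=
  fst (proj1_sig p).

Definition proj_r {X1 X2 : Sets} {R : X1 -> X2 -> Prop} (p : graph R) : X2 :=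
  snd (proj1_sig p).

Definition simulation {F : functor} (le : order F) {X1 X2 : Sets}
    (c : X1 -> F X1) (d : X2 -> F X2) (R : X1 -> X2 -> Prop) : Prop :=
  forall (x : X1) (y : X2), R x y ->
    exists w : F (graph R),
      le X1 (c x) (fmap F proj_l w) /\ le X2 (fmap F proj_r w) (d y).

Section InducedOrder.
Variables (F G : functor) (alpha : nat_trans F G) (le : order G).

Let induced_rel (X : Sets) (u u' : F X) : Prop := le X (alpha X u) (alpha X u').

Lemma induced_preorder (X : Sets) : PreOrder (induced_rel X).
Proof.
destruct (order_preorder le X) as [le_refl le_trans]; split.
- intros u; apply le_refl.
- intros u v w; apply le_trans.
Qed.

Lemma induced_fmap (X Y : Sets) (f : X -> Y) (u u' : F X) :
  induced_rel X u u' -> induced_rel Y (fmap F f u) (fmap F f u').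
Proof.
unfold induced_rel; rewrite <- !naturality; apply order_fmap.
Qed.

Definition induced_order : order F := Order F induced_rel induced_preorder induced_fmap.
End InducedOrder.
Arguments induced_order {F G} alpha le.

(* Main.v *)
Require Import Defs.
From Stdlib Require Import FinFun.

(** Naturality at the two projections shows that [v : F (graph R)] witnesses the simulation
    condition for the induced order exactly when [alpha (graph R) v] witnesses it for [leG].
    Surjectivity of [alpha] at [graph R] puts every [G]-witness in this form. *)

Theorem theorem4 (F G : functor) (alpha : nat_trans F G)
    (alpha_surj : forall X : Sets, Surjective (alpha X))
    (leG : order G) (X1 X2 : Sets)
    (b1 : X1 -> G X1) (b2 : X2 -> G X2)
    (a1 : X1 -> F X1) (a2 : X2 -> F X2)
    (ab1 : forall x : X1, alpha X1 (a1 x) = b1 x)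
    (ab2 : forall x : X2, alpha X2 (a2 x) = b2 x)
    (R : X1 -> X2 -> Prop) :
  simulation leG b1 b2 R <-> simulation (induced_order alpha leG) a1 a2 R.
Proof.
split; intros simR x y Rxy; destruct (simR x y Rxy) as [w [lew wle]].
- destruct (alpha_surj (graph R) w) as [v <-].
  exists v; cbn; rewrite <- !naturality, ab1, ab2; split; assumption.
(* [cbn] exposes the comparison of [alpha]-images; naturality then moves [alpha] past [fmap] onto
   [w]. *)
- cbn in lew, wle; rewrite <- naturality, ab1 in lew.
  rewrite <- naturality, ab2 in wle.
  exists (alpha (graph R) w); split; assumption.
Qed.
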